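(* Let $m$ and $k\ge2$ be integers with $k\le\sqrt{m(\log 2)/e}$. Identify the indices $\{1,\ldots,n\}$, $n=\binom m2$, with the edges of the complete graph $K_m$, and let $\mathcal{C}$ be the class of the edge sets of all $N=\binom mk$ cliques of size $k$ (that is, complete subgraphs on $k$ vertices) of $K_m$, so that each $S\in\mathcal{C}$ has cardinality $K=\binom k2$. Then: (i) for all $\delta\in(0,1)$, $R^*_{\mathcal{C}}(\mu)\le\delta$ whenever $$\mu\ \ge\ 2\sqrt{\frac{1}{k-1}\log\left(\frac{me}{k}\right)}+4\sqrt{\frac{\log(2/\delta)}{k(k-1)}};$$ (ii) $R^*_{\mathcal{C}}(\mu)\ge 1/2$ whenever $\mu>0$ and $$\mu\ \le\ \sqrt{\frac1k\log\left(\frac{m}{2k}\right)}.$$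
   Context: Setting: $\mathcal{C}=\{S_1,\ldots,S_N\}$ is a class of $N$ distinct subsets of $\{1,\ldots,n\}$, all of the same cardinality $K$. Under $\mathbb{P}_0$, the components of the random vector $\mathbf{X}=(X_1,\ldots,X_n)$ are independent standard normal. For $S\in\mathcal{C}$, under $\mathbb{P}_S$ the components are independent with $X_i\sim\mathcal{N}(\mu,1)$ for $i\in S$ and $X_i\sim\mathcal{N}(0,1)$ for $i\notin S$, where $\mu>0$. The risk of a (measurable) test $f:\mathbb{R}^n\to\{0,1\}$ is $$R(f)=\mathbb{P}_0\{f(\mathbf{X})=1\}+\frac1N\sum_{S\in\mathcal{C}}\mathbb{P}_S\{f(\mathbf{X})=0\},$$ and $R^*=R^*_{\mathcal{C}}(\mu)$ denotes the minimum of $R(f)$ over all tests $f$. Equivalently, $R^*_{\mathcal{C}}(\mu)=1-\frac12\mathbb{E}_0|L(\mathbf{X})-1|$, where $L(\mathbf{x})=\frac1N\sum_{S\in\mathcal{C}}e^{\mu x_S-K\mu^2/2}$ with $x_S=\sum_{i\in S}x_i$. *)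

(* Defs.v *)
From HB Require Import structures.
From mathcomp Require Import all_boot all_order all_algebra.
From mathcomp Require Import all_classical all_reals all_analysis.

Set Implicit Arguments.
Unset Strict Implicit.
Unset Printing Implicit Defensive.

Import Order.TTheory GRing.Theory Num.Theory.
Local Open Scope classical_set_scope.
Local Open Scope ring_scope.

Section product_of_probabilities.
Context d (T : measurableType d) (R : realType).

Definition tcons n (x : T * n.-tuple T) : n.+1.-tuple T := [tuple of x.1 :: x.2].

Lemma measurable_tcons n : measurable_fun setT (@tcons n).
Proof. exact: measurable_cons. Qed.

HB.instance Definition _ n := isMeasurableFun.Build _ _ _ _ (@tcons n)
  (@measurable_tcons n).

(* Law of n independent variables, the i-th one with law P i, on the product
   sigma-algebra of n.-tuple T; [prod_prob_box] below characterizes it. *)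
Fixpoint prod_prob n : ('I_n -> probability T R) -> probability (n.-tuple T) R :=
  match n with
  | 0 => fun=> \d_([tuple] : 0.-tuple T)
  | n'.+1 => fun P =>
      distribution (P ord0 \x prod_prob (fun i => P (lift ord0 i)))%E (@tcons n')
  end.

Lemma measurable_box n (A : 'I_n -> set T) : (forall i, measurable (A i)) ->
  measurable [set x : n.-tuple T | forall i, A i (tnth x i)].
Proof.
move=> mA; rewrite (_ : mkset _ =
    \bigcap_(i in [set: 'I_n]) ((@tnth n T ^~ i) @^-1` A i)).
  apply: fin_bigcap_measurable => // i _; rewrite -[_ @^-1` _]setTI.
  exact: measurable_tnth.
by apply/seteqP; split => x /= h i; [move=> _; exact: h|exact: h].
Qed.

Lemma prod_prob_box n (P : 'I_n -> probability T R) (A : 'I_n -> set T) :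
  (forall i, measurable (A i)) ->
  (prod_prob P [set x | forall i, A i (tnth x i)] = \prod_(i < n) P i (A i))%E.
Proof.
elim: n => [|n IH] in P A * => mA.
  by rewrite big_ord0 /= diracE mem_set// => -[].
rewrite big_ord_recl -IH//= /distribution /pushforward -product_measure1E//.
  congr ((_ \x _)%E _); apply/seteqP; split => -[x y] /=.
    move=> h; split; first exact: (h ord0).
    by move=> i; have := h (lift ord0 i); rewrite tnthS.
  move=> [h0 h] i; case: (unliftP ord0 i) => [j ->|->//].
  by rewrite tnthS.
exact: (measurable_box (A := fun i => A (lift ord0 i))).
Qed.

End product_of_probabilities.

Section testing_problem.
Context (R : realType) (n : nat).
Implicit Types (S : {set 'I_n}) (C : {set {set 'I_n}}) (mu : R).

(* Law of X on R^n when the X_i are independent, X_i ~ N(mu, 1) for i in S and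
   X_i ~ N(0, 1) otherwise. *)
Definition law mu S : probability (n.-tuple (measurableTypeR R)) R :=
  prod_prob (fun i => normal_prob (if i \in S then mu else 0) 1).

Definition law0 : probability (n.-tuple (measurableTypeR R)) R :=
  prod_prob (fun=> normal_prob 0 1).

Definition risk C mu (f : {mfun n.-tuple (measurableTypeR R) >-> bool}) : R :=
  fine (law0 [set x | f x = true]) +
  #|C|%:R^-1 * \sum_(S in C) fine (law mu S [set x | f x = false]).

(* The infimum is a minimum: see [min_risk_attained]. *)
Definition min_risk C mu : R := inf [set risk C mu f | f in setT].

Lemma risk_charge C mu : (0 < #|C|)%N ->
  exists nu : {charge set (n.-tuple (measurableTypeR R)) -> \bar R},
  forall f : {mfun n.-tuple (measurableTypeR R) >-> bool},
    risk C mu f = 1 + fine (nu [set x | f x = true]).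
Proof.
move=> C0.
have [nu nuE] : exists nu : {charge set (n.-tuple (measurableTypeR R)) -> \bar R}, forall A,
    nu A = (\sum_(S <- enum C) law mu S A)%E.
  elim: (enum C) => [|S s [nu IH]].
    by exists czero => A; rewrite big_nil.
  by exists (cadd (charge_of_finite_measure (law mu S)) nu) => A; rewrite big_cons -IH.
exists (cadd (charge_of_finite_measure law0) (cscale (- (#|C|%:R^-1)) nu)) => f.
have mf b : measurable [set x | f x = b].
  rewrite -[X in measurable X]setTI.
  exact: (measurable_funPT f measurableT [set b]).
have fC : [set x | f x = false] = ~` [set x | f x = true].
  by apply/seteqP; split => x /=; case: (f x).
have finl (P : probability (n.-tuple (measurableTypeR R)) R) b :
    P [set x | f x = b] \is a fin_num by rewrite fin_num_measure.
have finnu : nu [set x | f x = true] \is a fin_num by rewrite fin_num_measure.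
rewrite /risk /=.
rewrite -[fine (cadd _ _ _)]/(fine (law0 [set x | f x = true] +
  (- (#|C|%:R^-1))%:E * nu [set x | f x = true])%E).
rewrite fineD ?finl ?fin_numM// fineM//= nuE big_enum/= -sum_fine//=.
under eq_bigr => S _ do rewrite fC probability_setC// fineB//=.
rewrite big_split/= sumr_const sumrN mulrBr mulVf ?pnatr_eq0 -?lt0n//.
by rewrite mulNr addrCA.
Qed.

Lemma min_risk_attained C mu : (0 < #|C|)%N ->
  exists2 f, risk C mu f = min_risk C mu & forall g, risk C mu f <= risk C mu g.
Proof.
move=> C0; have [nu nuE] := risk_charge mu C0.
have [P [N [[mP posP] [mN negN] PN PN0]]] := Hahn_decomposition nu.
have mf : measurable_fun setT (fun x => x \in N).
  apply: (measurable_fun_bool true).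
  by rewrite setTI preimage_mem_true.
pose f : {mfun n.-tuple (measurableTypeR R) >-> bool} :=
  HB.pack (fun x => x \in N) (isMeasurableFun.Build _ _ _ _ _ mf).
have fN : [set x | f x = true] = N by rewrite -[RHS]preimage_mem_true.
have fmin g : risk C mu f <= risk C mu g.
  rewrite !nuE lerD2l fN.
  set G := [set x | g x = true].
  have mG : measurable G.
    rewrite -[G]setTI; exact: (measurable_funPT g measurableT [set true]).
  rewrite fine_le ?fin_num_measure//.
  have mNG := measurableD mN mG; have mGN := measurableD mG mN.
  have mI := measurableI _ _ mG mN.
  rewrite (chargeDI nu mN mG) (chargeDI nu mG mN) setIC leeD2r//.
  apply: (@le_trans _ _ 0%E); first by apply: negN => //; exact: subDsetl.
  apply: posP => // x [_ Nx].
  by have [//|] : (P `|` N) x by rewrite PN.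
exists f => //; apply/esym/eqP; rewrite eq_le; apply/andP; split.
  apply: ge_inf; last by exists f.
  by exists (risk C mu f) => _ [g _ <-].
apply: lb_le_inf; first by exists (risk C mu f), f.
by move=> _ [g _ <-].
Qed.

End testing_problem.

(* Class of the edge sets of the k-cliques of K_m, where e numbers the edges of
   K_m (the two-element subsets of 'I_m). *)
Definition clique_class (m n k : nat) (e : 'I_n -> {set 'I_m}) :
    {set {set 'I_n}} :=
  [set [set i | e i \subset V] | V : {set 'I_m} & #|V| == k]%SET.

Lemma card_clique m n k (e : 'I_n -> {set 'I_m}) : injective e ->
  (forall A : {set 'I_m}, #|A| = 2%N <-> exists i, e i = A) ->
  forall S, S \in clique_class k e -> #|S| = 'C(k, 2).
Proof.
move=> ei eE S /imsetP[V]; rewrite inE => /eqP <- ->.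
rewrite -cards_draws -(card_imset _ ei); apply: eq_card => A.
apply/imsetP/idP => [[i]|]; rewrite !inE.
  by move=> iV ->; rewrite iV; apply/eqP/eE; exists i.
by move=> /andP[AV /eqP/eE[i eiA]]; exists i; rewrite ?inE eiA.
Qed.

Lemma card_clique_class m n k (e : 'I_n -> {set 'I_m}) : (2 <= k)%N ->
  (forall A : {set 'I_m}, #|A| = 2%N <-> exists i, e i = A) ->
  #|clique_class k e| = 'C(m, k).
Proof.
move=> k2 eE; rewrite card_in_imset.
  by rewrite -[in RHS](card_ord m) -card_draws; apply: eq_card => V; rewrite !inE.
have sub (V W : {set 'I_m}) : #|V| == k ->
    [set i | e i \subset V]%SET = [set i | e i \subset W]%SET -> V \subset W.
  move=> /eqP cV eVW; apply/fintype.subsetP => x xV.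
  have : (0 < #|V :\ x|)%N by rewrite -ltnS -add1n -[X in (_ < X)%N]/(true + _)%N -xV -cardsD1 cV.
  rewrite card_gt0 => /set0Pn[y]; rewrite !inE => /andP[yx yV].
  have /eE[i eixy] : #|[set x; y]%SET| = 2%N by rewrite cards2 eq_sym yx.
  have : (i \in [set i | e i \subset V]%SET).
    by rewrite inE eixy finset.subUset !finset.sub1set xV yV.
  by rewrite eVW inE eixy finset.subUset !finset.sub1set => /andP[].
move=> V W; rewrite !inE => cV cW /= VW.
by apply/eqP; rewrite finset.eqEsubset (sub V W)// (sub W V).
Qed.

(* Main.v *)
Require Import Defs.
From HB Require Import structures.
From mathcomp Require Import all_boot all_order all_algebra.
From mathcomp Require Import all_classical all_reals all_analysis.
From mathcomp Require Import measurable_realfun ring lra zify.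

Set Implicit Arguments.
Unset Strict Implicit.
Unset Printing Implicit Defensive.

Import Order.TTheory GRing.Theory Num.Theory.
Local Open Scope classical_set_scope.
Local Open Scope ring_scope.

(* (i) The scan test rejects when [X_S >= t] for some [S]. By the Chernoff bound
   and a union bound its two errors are at most [N exp(- t^2 / 2K)] and
   [exp(- (mu K - t)^2 / 2K)], and [N = 'C(m, k) <= (m e / k)^k].
   (ii) Writing [L] for the average likelihood ratio, every test satisfies
   pointwise [L <= 1_(f = 1) + L 1_(f = 0) + L^2 / 4], hence
   [risk f >= 1 - E_0 L^2 / 4], and it suffices that [E_0 L^2 <= 2]. With
   [q = exp(mu^2)] and [V], [V'] independent uniform [k]-sets,
   [E_0 L^2 = E q^'C(|V :&: V'|, 2)
      <= E (\sum_(J \subset V :&: V') q^'C(|J|, 2))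
      <= \sum_j 'C(k, j) (k / m)^j q^'C(j, 2)],
   and consecutive terms of this last sum have ratio at most [1/2]. *)

(** * Change of measure: densities on one factor and on finite products *)

Import HBNNSimple.

(** Both sides are limits, by monotone convergence, of the same integrals for the simple functions
    [h n] increasing to [f]; for a simple function the claim reduces to [nuE] on its level sets. *)
Lemma ge0_integral_density d (T : measurableType d) (R : realType)
    (mu nu : {measure set T -> \bar R}) (g : T -> R) :
    measurable_fun setT g -> (forall x, 0 <= g x) ->
    (forall A, measurable A -> nu A = (\int[mu]_(x in A) (g x)%:E)%E) ->
  forall f : T -> \bar R, measurable_fun setT f -> (forall x, 0 <= f x)%E ->
  (\int[nu]_x f x = \int[mu]_x (f x * (g x)%:E))%E.
Proof.
move=> mg g0 nuE f mf f0.
pose h := nnsfun_approx measurableT mf.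
have hf x : (EFin \o h n) x @[n --> \oo] --> f x.
  by apply: cvg_nnsfun_approx.
have -> : (\int[nu]_x f x =
    lim (\int[nu]_x (EFin \o h n) x @[n --> \oo]))%E.
  rewrite -monotone_convergence//.
  - by apply: eq_integral => x _; exact/esym/cvg_lim.
  - by move=> n; exact/measurable_EFinP.
  - by move=> n x _ /=; rewrite lee_fin.
  - by move=> x _ a b ab; rewrite lee_fin; exact/lefP/nd_nnsfun_approx.
have -> : (\int[mu]_x (f x * (g x)%:E) =
    lim (\int[mu]_x ((EFin \o h n) x * (g x)%:E) @[n --> \oo]))%E.
  rewrite -monotone_convergence//.
  - apply: eq_integral => x _; apply/esym/cvg_lim => //.
    by apply: cvgeZr => //; exact: hf.
  - by move=> n; apply: emeasurable_funM; exact/measurable_EFinP.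
  - by move=> n x _ /=; rewrite mule_ge0// lee_fin.
  - move=> x _ a b ab /=; rewrite lee_wpmul2r// lee_fin//.
    exact/lefP/nd_nnsfun_approx.
apply: congr_lim; apply/funext => n.
rewrite integralT_nnsfun sintegralE.
under [RHS]eq_integral => x _.
  rewrite /= fimfunE -fsumEFin// ge0_mule_fsuml; last first.
    by move=> y; exact: nnfun_muleindic_ge0.
  over.
rewrite ge0_integral_fsum//; last 2 first.
  - move=> r; apply: emeasurable_funM; apply/measurable_EFinP => //.
    exact: measurable_funM.
  - move=> r x _; apply: mule_ge0; last by rewrite lee_fin.
    by rewrite EFinM nnfun_muleindic_ge0.
(* Only attained values of [h n] occur in the sum, and writing [r] as [h n t] provides its
   nonnegativity. *)
apply: eq_fsbigr => r; rewrite inE => -[t _ <-].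
have mA : measurable (h n @^-1` [set h n t]) by [].
rewrite nuE// integral_mkcond -ge0_integralZl//.
- apply: eq_integral => x _; rewrite epatch_indic.
  by rewrite -!EFinM mulrAC mulrA.
- apply/(measurable_restrictT _ mA).
  exact/measurable_EFinP/measurable_funTS.
- by move=> x _; rewrite erestrict_ge0// => y _; rewrite lee_fin.
- by rewrite lee_fin.
Qed.

(** Both laws have a density for Lebesgue measure, and completing the square gives [- (x - a)^2 / 2
    = - x^2 / 2 + (a x - a^2 / 2)]. *)
Lemma normal_prob_tilt (R : realType) (a : R) (A : set (measurableTypeR R)) :
    measurable A ->
  (normal_prob a 1 A =
   \int[normal_prob 0 1]_(x in A) (expR (a * x - a ^+ 2 / 2))%:E)%E.
Proof.
move=> mA.
have mexp : measurable_fun setT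
    (fun x : measurableTypeR R => expR (a * x - a ^+ 2 / 2)).
  by apply: measurableT_comp => //; exact: measurable_funB.
rewrite [RHS]integral_mkcond.
rewrite (@ge0_integral_density _ _ _ lebesgue_measure (normal_prob 0 1)
  (normal_pdf 0 1))//.
- rewrite /normal_prob [LHS]integral_mkcond; apply: eq_integral => x _.
  rewrite !patchE; case: ifPn => _; last by rewrite mul0e.
  rewrite -EFinM !normal_pdfE ?oner_neq0//; congr EFin.
  rewrite mulrCA; congr (_ * _).
  rewrite /normal_fun -expRD; congr expR.
  by field.
- exact: measurable_normal_pdf.
- by move=> x; exact: normal_pdf_ge0.
- apply/(measurable_restrictT _ mA).
  exact/measurable_EFinP/measurable_funTS.
- by move=> x; rewrite erestrict_ge0// => y _; rewrite lee_fin expR_ge0.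
Qed.

(** Induction on [n]: after pulling back along [tcons], Tonelli separates the first coordinate,
    which is handled by the one-variable change of measure, from the others, which are handled by
    the induction hypothesis on sections. *)
Lemma prod_prob_density d (T : measurableType d) (R : realType) n
    (P Q : 'I_n -> probability T R) (l : 'I_n -> T -> R) :
    (forall i, measurable_fun setT (l i)) -> (forall i x, 0 <= l i x) ->
    (forall i A, measurable A ->
      Q i A = (\int[P i]_(x in A) (l i x)%:E)%E) ->
  forall A, measurable A ->
  prod_prob Q A =
    (\int[prod_prob P]_(x in A) (\prod_(i < n) l i (tnth x i))%:E)%E.
Proof.
elim: n P Q l => [|n IH] P Q l ml l0 QE A mA.
  rewrite /= integral_dirac//; last first.
    by apply/measurable_EFinP; apply: measurable_prod => -[].
  by rewrite big_ord0 mule1.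
pose l' i := l (lift ord0 i).
pose G (x : n.-tuple T) := \prod_(i < n) l' i (tnth x i).
have mG : measurable_fun setT G.
  apply: measurable_prod => i _.
  by apply: measurableT_comp; [exact: ml|exact: measurable_tnth].
have G0 x : 0 <= G x by apply: prodr_ge0 => i _; exact: l0.
pose B := @tcons _ T n @^-1` A.
have mB : measurable B.
  by rewrite -[B]setTI; apply: measurable_tcons.
have IH' : forall C, measurable C -> prod_prob (fun i => Q (lift ord0 i)) C =
    (\int[prod_prob (fun i => P (lift ord0 i))]_(x in C) (G x)%:E)%E.
  by move=> C mC; apply: IH => // i; [exact: ml|exact: l0|exact: QE].
have mGB : measurable_fun setT
    (fun z : T * n.-tuple T => (l ord0 z.1 * G z.2 * \1_B z)%:E).
  apply/measurable_EFinP; apply: measurable_funM => //.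
  by apply: measurable_funM; apply: measurableT_comp.
have GB0 z : (0 <= (l ord0 z.1 * G z.2 * \1_B z)%:E)%E.
  by rewrite lee_fin !mulr_ge0.
have mF : measurable_fun setT (fun x => \prod_(i < n.+1) l i (tnth x i)).
  apply: measurable_prod => i _.
  by apply: measurableT_comp; [exact: ml|exact: measurable_tnth].
rewrite integral_mkcond /=.
rewrite ge0_integral_distribution; last 2 first.
- apply/(measurable_restrictT _ mA).
  exact/measurable_EFinP/measurable_funTS.
- move=> x; apply: erestrict_ge0 => y _.
  by rewrite lee_fin prodr_ge0.
have -> : ((fun x => (\prod_i l i (tnth x i))%:E) \_ A)%E \o @tcons _ T n =
    fun z : T * n.-tuple T => (l ord0 z.1 * G z.2 * \1_B z)%:E.
  apply/funext => z; rewrite /= epatch_indic -EFinM big_ord_recl tnth0.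
  congr (_ * _ * _)%:E.
  by apply: eq_bigr => i _; rewrite tnthS.
rewrite fubini_tonelli1//.
rewrite /distribution /pushforward /= /product_measure1 /=.
(* The left side is now the [Q ord0]-integral of the product measure of the sections of [B]; trading
   [Q ord0] for [P ord0] brings in the factor [l ord0]. *)
rewrite (@ge0_integral_density _ _ _ (P ord0) (Q ord0) (l ord0))//.
- apply: eq_integral => x _.
  have mBx : measurable (xsection B x) by exact: measurable_xsection.
  rewrite IH'// /fubini_F /= integral_mkcond muleC -ge0_integralZl//.
  + apply: eq_integral => y _.
    rewrite epatch_indic !EFinM muleA; congr (_ * _)%E.
    by rewrite !indicE; congr (_%:R%:E); rewrite mem_xsection.
  + apply/(measurable_restrictT _ mBx).
    exact/measurable_EFinP/measurable_funTS.
  + by move=> y _; apply: erestrict_ge0 => z _; rewrite lee_fin.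
  + by rewrite lee_fin.
- by move=> C mC; exact: QE.
- exact: (@measurable_fun_xsection _ _ _ _ _
    (prod_prob (fun i => Q (lift ord0 i))) B mB).
Qed.

(** * Gaussian vectors: likelihood ratios, exponential moments, tails *)

Section gaussian_vectors.
Context (R : realType) (n : nat).
Local Notation T := (n.-tuple (measurableTypeR R)).
Implicit Types (a : 'I_n -> R) (S : {set 'I_n}).

Lemma measurable_linear a :
  measurable_fun setT (fun x : T => \sum_(i < n) a i * tnth x i).
Proof.
apply: measurable_sum => i; apply: measurable_funM => //.
exact: measurable_tnth.
Qed.

Lemma measurable_sum_tnth S :
  measurable_fun setT (fun x : T => \sum_(i in S) tnth x i).
Proof.
rewrite (_ : (fun _ => _) = fun x => \sum_(i < n) (i \in S)%:R * tnth x i).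
  exact: measurable_linear.
apply/funext => x; rewrite big_mkcond; apply: eq_bigr => i _.
by case: ifP; rewrite ?mul1r ?mul0r.
Qed.

Lemma normal_vector_density a (A : set T) : measurable A ->
  (prod_prob (fun i => normal_prob (a i) 1) A = \int[law0 R n]_(x in A)
    (expR (\sum_(i < n) a i * tnth x i - (\sum_(i < n) a i ^+ 2) / 2))%:E)%E.
Proof.
move=> mA.
rewrite (@prod_prob_density _ _ _ _ (fun=> normal_prob 0 1) _
  (fun i x => expR (a i * x - a i ^+ 2 / 2)))//.
- apply: eq_integral => x _; rewrite -expR_sum.
  by rewrite big_split/= sumrN -mulr_suml.
- move=> i; apply: measurableT_comp => //; apply: measurable_funB => //.
- by move=> i B mB; exact: normal_prob_tilt.
Qed.

(** The likelihood ratio of the normal law with mean vector [a] integrates to 1, and its constant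
    factor can be moved to the other side. *)
Lemma law0_mgf a :
  (\int[law0 R n]_x (expR (\sum_(i < n) a i * tnth x i))%:E =
   (expR ((\sum_(i < n) a i ^+ 2) / 2))%:E)%E.
Proof.
pose c := (\sum_(i < n) a i ^+ 2) / 2.
have := @normal_vector_density a setT measurableT.
rewrite probability_setT.
under eq_integral => x _ do rewrite expRD mulrC EFinM.
rewrite ge0_integralZl ?lee_fin ?expR_ge0//; last first.
  by apply/measurable_EFinP/measurableT_comp => //; exact: measurable_linear.
move=> /(congr1 (fun y => (expR c)%:E * y)%E).
by rewrite mule1 muleA -EFinM -expRD subrr expR0 mul1e => ->.
Qed.

Lemma law_density (mu : R) S (A : set T) : measurable A ->
  (law mu S A = \int[law0 R n]_(x in A)
    (expR (mu * \sum_(i in S) tnth x i - #|S|%:R * mu ^+ 2 / 2))%:E)%E.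
Proof.
move=> mA; pose a i := if i \in S then mu else 0.
have E1 (x : T) : \sum_(i < n) a i * tnth x i = mu * \sum_(i in S) tnth x i.
  rewrite mulr_sumr [RHS]big_mkcond; apply: eq_bigr => i _.
  by rewrite /a; case: ifP; rewrite ?mul0r.
have E2 : \sum_(i < n) a i ^+ 2 = #|S|%:R * mu ^+ 2.
  rewrite mulr_natl -sumr_const [RHS]big_mkcond; apply: eq_bigr => i _.
  by rewrite /a; case: ifP; rewrite ?expr0n.
have := normal_vector_density a mA; rewrite E2.
by under eq_integral do rewrite E1.
Qed.

(** The exponent is linear with coefficients [b 1_S + c 1_S'], whose squared norm has a cross term
    counting [S :&: S']. This is how overlaps enter the second moment. *)
Lemma law0_mgf_sum2 (b c : R) S S' :
  (\int[law0 R n]_x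
    (expR (b * \sum_(i in S) tnth x i + c * \sum_(i in S') tnth x i))%:E =
   (expR ((#|S|%:R * b ^+ 2 + #|S'|%:R * c ^+ 2) / 2
     + #|S :&: S'|%:R * (b * c)))%:E)%E.
Proof.
pose a i := b * (i \in S)%:R + c * (i \in S')%:R.
have sumE (T' : {set 'I_n}) (f : 'I_n -> R) :
    \sum_(i in T') f i = \sum_(i < n) (i \in T')%:R * f i.
  by rewrite big_mkcond; apply: eq_bigr => i _; case: ifP; rewrite ?mul1r ?mul0r.
have cardE (T' : {set 'I_n}) : #|T'|%:R = \sum_(i < n) (i \in T')%:R :> R.
  by rewrite -sum1_card natr_sum sumE; apply: eq_bigr => i _; rewrite mulr1.
under eq_integral => x _.
  rewrite !sumE !mulr_sumr -big_split/=.
  under eq_bigr => i _ do rewrite !mulrA -mulrDl.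
  over.
rewrite (law0_mgf a) !cardE !mulr_suml -!big_split/= mulr_suml -big_split/=.
congr (expR _)%:E; apply: eq_bigr => i _.
rewrite /a finset.in_setI.
by case: (i \in S); case: (i \in S'); rewrite /=; field.
Qed.

Lemma law0_mgf_sum (c : R) S :
  (\int[law0 R n]_x (expR (c * \sum_(i in S) tnth x i))%:E =
   (expR (#|S|%:R * c ^+ 2 / 2))%:E)%E.
Proof.
have := law0_mgf_sum2 c 0 S S.
under eq_integral => x _ do rewrite mul0r addr0.
by move=> ->; congr (expR _)%:E; ring.
Qed.

(** One statement covers both tails: the sign of [t - mu K] decides whether [A] lies in the upper or
    in the lower tail of [X_S]. *)
Lemma law_chernoff (mu t : R) S (A : set T) : (0 < #|S|)%N -> measurable A ->
  (forall x, A x ->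
    0 <= (t - mu * #|S|%:R) * (\sum_(i in S) tnth x i - t)) ->
  (law mu S A <= (expR (- ((t - mu * #|S|%:R) ^+ 2 / (2 * #|S|%:R))))%:E)%E.
Proof.
move=> S0 mA tA; have K0 : 0 < #|S|%:R :> R by rewrite ltr0n.
set K := #|S|%:R in tA K0 *.
(* On [A] the indicator is at most [exp(v (X_S - t))] because [v] has the sign of [t - mu K]. This
   [v] minimizes the resulting exponent [K v^2 / 2 - v (t - mu K)]. *)
pose v := (t - mu * K) / K.
have mexp (b c : R) : measurable_fun setT
    (fun x : T => (expR (b * \sum_(i in S) tnth x i - c))%:E).
  apply/measurable_EFinP/measurableT_comp => //; apply: measurable_funB => //.
  by apply: measurable_funM => //; exact: measurable_sum_tnth.
rewrite law_density// integral_mkcond.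
apply: (@le_trans _ _ (\int[law0 R n]_x
   ((expR (- (v * t + K * mu ^+ 2 / 2)))%:E *
    (expR ((mu + v) * \sum_(i in S) tnth x i - 0))%:E))%E).
  apply: ge0_le_integral => //.
  - by move=> x _; apply: erestrict_ge0 => y _; rewrite lee_fin expR_ge0.
  - by apply/(measurable_restrictT _ mA); apply: measurable_funTS; exact: mexp.
  - by apply: measurable_funeM; exact: mexp.
  - move=> x _; rewrite patchE; case: ifPn => [|_]; last first.
      by rewrite mule_ge0// lee_fin expR_ge0.
    rewrite inE => Ax; rewrite -EFinM lee_fin -expRD ler_expR.
    have : 0 <= v * (\sum_(i in S) tnth x i - t).
      by rewrite /v mulrAC divr_ge0 ?tA// ltW.
    rewrite -/K; lra.
rewrite ge0_integralZl ?lee_fin ?expR_ge0//.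
under eq_integral => x _ do rewrite subr0.
rewrite law0_mgf_sum -EFinM lee_fin -expRD ler_expR -/K /v.
rewrite le_eqVlt; apply/orP; left; apply/eqP; field.
by rewrite gt_eqF.
Qed.

End gaussian_vectors.

(** * Combinatorial estimates for the second moment *)

(** Start from [j^j <= (j + 1)^j] and increase the other variable: passing from [l] to [l + 1]
    multiplies the right side by [j + 1], while [(l + 1)^j <= (j + 1) l^j] as long as [j <= l]. *)
Lemma expn_le_succ_expn j k : (j <= k)%N -> (k ^ j <= j.+1 ^ k)%N.
Proof.
have succ i l : (i <= l)%N -> (l.+1 ^ i <= i.+1 * l ^ i)%N.
  elim: i => [|i IH] // il; rewrite !expnS.
  have := IH (ltnW il).
  rewrite -(leq_pmul2l (ltn0Sn l)) => /leq_trans; apply.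
  by rewrite !mulnA leq_mul2r; apply/orP; right; lia.
move=> /subnKC <-; elim: (k - j)%N => [|d IH].
  by rewrite addn0; case: j => // j; rewrite leq_exp2r.
rewrite addnS [in leqRHS]expnS; apply: (leq_trans (succ _ _ (leq_addr _ _))).
by rewrite leq_mul2l IH orbT.
Qed.

Section clique_series.
Context (R : realFieldType) (k : nat) (x q : R).
Hypotheses (x_ge0 : 0 <= x) (q_ge0 : 0 <= q).
Hypotheses (kx : 2 * (k%:R * x) <= 1) (qx : 2 * x * q ^+ k <= 1).

(* The [k]-th power of the left-hand side is
   [(k - j)^k * (2 x)^(k - j) * (2 x q^k)^j <= k^j]. *)
Lemma clique_ratio j : (j <= k)%N ->
  2 * ((k - j)%:R * x * q ^+ j) <= j.+1%:R.
Proof.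
move=> jk; case: (posnP k) => [k0|k0].
  by rewrite k0 sub0n !mul0r mulr0.
rewrite -(@ler_pXn2r _ k) ?nnegrE ?mulr_ge0 ?exprn_ge0//.
have -> : (2 * ((k - j)%:R * x * q ^+ j)) ^+ k =
    (k - j)%:R ^+ k * (2 * x) ^+ (k - j) * (2 * x * q ^+ k) ^+ j.
  have split_k (y : R) : y ^+ k = y ^+ (k - j) * y ^+ j by rewrite -exprD subnK.
  rewrite !exprMn -!exprM (split_k 2) (split_k x) (mulnC j).
  by ring.
rewrite -[leRHS]natrX; apply: (@le_trans _ _ ((k - j)%:R ^+ k * (2 * x) ^+ (k - j))).
  by rewrite ler_piMr ?mulr_ge0 ?exprn_ge0 ?exprn_ile1 ?mulr_ge0 ?exprn_ge0.
apply: (@le_trans _ _ ((k ^ j)%:R * (2 * (k%:R * x)) ^+ (k - j))).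
  rewrite [2 * (_ * x)]mulrCA [in leRHS]exprMn mulrA natrX -exprD subnKC//.
  rewrite ler_wpM2r ?exprn_ge0 ?mulr_ge0//.
  by rewrite -!natrX ler_nat leq_exp2r// leq_subr.
apply: (@le_trans _ _ (k ^ j)%:R).
  by rewrite ler_piMr// exprn_ile1// !mulr_ge0.
by rewrite ler_nat expn_le_succ_expn.
Qed.

Let a j : R := 'C(k, j)%:R * x ^+ j * q ^+ 'C(j, 2).

Lemma clique_series_le : \sum_(j < k.+1) a j <= 2.
Proof.
have a_ge0 j : 0 <= a j by rewrite !mulr_ge0 ?exprn_ge0.
have aS j : 2 * a j.+1 <= a j.
  have [jk|kj] := leqP j k; last first.
    by rewrite /a bin_small ?mul0r ?mulr0 ?a_ge0// ltnW.
  rewrite -(ler_pM2l (ltr0Sn R j)).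
  have -> : j.+1%:R * (2 * a j.+1) = 2 * ((k - j)%:R * x * q ^+ j) * a j.
    have E : j.+1%:R * 'C(k, j.+1)%:R = (k - j)%:R * 'C(k, j)%:R :> R.
      by rewrite -!natrM mul_bin_left.
    rewrite /a binS bin1 exprD exprS.
    transitivity (2 * (j.+1%:R * 'C(k, j.+1)%:R) * x * x ^+ j *
      (q ^+ 'C(j, 2) * q ^+ j)); first by ring.
    by rewrite E; ring.
  by rewrite ler_wpM2r// clique_ratio.
(* Halving, [2 a_(l+1) <= a_l], is the same as [a_l <= 2 (a_l - a_(l+1))], so the sum telescopes;
   [a_0 = 1]. *)
suff H l : \sum_(j < l) a j <= 2 * (a 0%N - a l).
  apply: (le_trans (H _)); rewrite /a bin0 !expr0.
  by have := a_ge0 k.+1; rewrite /a; lra.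
elim: l => [|l IH]; first by rewrite big_ord0 subrr mulr0.
by rewrite big_ord_recr/=; have := aS l; lra.
Qed.

End clique_series.

(** Complements turn supersets of [J] into subsets of [~: J]. Counting the elements left out, rather
    than [k - #|J|] added ones, keeps the formula right when [#|J| > k]: both sides are then 0. *)
Lemma card_supersets (T : finType) (J : {set T}) k : (k <= #|T|)%N ->
  #|[set V : {set T} | (J \subset V) && (#|V| == k)]%SET| =
  'C(#|T| - #|J|, #|T| - k).
Proof.
move=> kT; have := cards_draws (~: J)%SET (#|T| - k)%N.
have cC (A : {set T}) : #|~: A|%SET = (#|T| - #|A|)%N.
  by rewrite cardsCs finset.setCK.
rewrite cC => <-.
rewrite -(card_imset _ (@finset.setC_inj T)); apply: eq_card => V.
apply/imsetP/idP => [[W]|]; rewrite !inE.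
  by move=> /andP[JW /eqP kW] ->; rewrite finset.setCS JW/= cC kW eqxx.
move=> /andP[VJ /eqP cV]; exists (~: V)%SET; last by rewrite finset.setCK.
rewrite inE -finset.setCS finset.setCK VJ/= cC cV.
by rewrite subKn.
Qed.

(** A fixed [j]-set lies in a uniform random [k]-set with probability the product of the
    [(k - i) / (m - i)], each at most [k / m]; denominators are cleared to stay in the integers. *)
Lemma bin_sub_expn_le m k j : (j <= k)%N -> (k <= m)%N ->
  ('C(m - j, m - k) * m ^ j <= 'C(m, k) * k ^ j)%N.
Proof.
move=> jk km; elim: j jk => [|j IH] jk; first by rewrite subn0 bin_sub.
have mj : (0 < m - j)%N by lia.
rewrite -(leq_pmul2l mj) expnS.
have := mul_bin_down (m - j) (m - k).
rewrite -subnS (_ : (m - j - (m - k) = k - j)%N); last by lia.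
move=> E; rewrite mulnA E.
apply: (@leq_trans ((k - j) * m * ('C(m, k) * k ^ j))%N).
  rewrite -[leqLHS]mulnA -[leqRHS]mulnA leq_mul2l; apply/orP; right.
  by rewrite mulnCA leq_mul2l IH ?orbT// ltnW.
rewrite (expnS k) (mulnCA _ k) [leqRHS]mulnA leq_mul2r; apply/orP; right.
by nia.
Qed.

(** The hypergeometric size of [V :&: W] is avoided: summing over all [J] inside the intersection
    leaves only the events that [W] contains [J], counted by [card_supersets]. *)
Lemma sum_bin_expr_le (R : realFieldType) m k (q : R) (V : {set 'I_m}) :
  (0 < m)%N -> 0 <= q -> #|V| = k ->
  \sum_(W : {set 'I_m} | #|W| == k) q ^+ 'C(#|V :&: W|, 2) <=
  'C(m, k)%:R *
    \sum_(j < k.+1) 'C(k, j)%:R * (k%:R / m%:R) ^+ j * q ^+ 'C(j, 2).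
Proof.
move=> m0 q0 cV.
have km : (k <= m)%N by rewrite -cV -[X in (_ <= X)%N]card_ord max_card.
(* The left side keeps only the term [J = V :&: W] of the inner sum. *)
apply: (@le_trans _ _ (\sum_(W : {set 'I_m} | #|W| == k)
    \sum_(J : {set 'I_m} | J \subset V :&: W) q ^+ 'C(#|J|, 2))).
  apply: ler_sum => W _; rewrite (bigD1 (V :&: W)%SET)//= lerDl.
  by apply: sumr_ge0 => J _; rewrite exprn_ge0.
rewrite (exchange_big_dep (fun J : {set 'I_m} => J \subset V))/=; last first.
  by move=> W J _; rewrite finset.subsetI => /andP[].
apply: (@le_trans _ _ (\sum_(J : {set 'I_m} | J \subset V)
    'C(m, k)%:R * ((k%:R / m%:R) ^+ #|J| * q ^+ 'C(#|J|, 2)))).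
  apply: ler_sum => J JV; rewrite mulrA sumr_const -[leLHS]mulr_natl.
  rewrite ler_wpM2r ?exprn_ge0//.
  have jk : (#|J| <= k)%N by rewrite -cV subset_leq_card.
  rewrite (_ : #|_| = 'C(m - #|J|, m - k)); last first.
    have := @card_supersets _ J k; rewrite card_ord => <-//.
    by apply: eq_card => W; rewrite inE unfold_in/= finset.subsetI JV andbC.
  rewrite expr_div_n mulrA ler_pdivlMr ?exprn_gt0 ?ltr0n//.
  by rewrite -!natrX -!natrM ler_nat bin_sub_expn_le.
rewrite -mulr_sumr ler_wpM2l//.
(* Group the [J] by size; [inord] never takes its default value, since [J \subset V] forces
   [#|J| <= k]. *)
rewrite (partition_big (fun J : {set 'I_m} => inord #|J| : 'I_k.+1) xpredT)//=.
apply: ler_sum => j _; rewrite le_eqVlt; apply/orP; left; apply/eqP.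
transitivity (\sum_(J in [set J : {set 'I_m} | J \subset V & #|J| == j]%SET)
    (k%:R / m%:R) ^+ j * q ^+ 'C(j, 2)); last first.
  by rewrite sumr_const cards_draws cV -[LHS]mulr_natl mulrA.
apply: eq_big => [J|J /andP[JV]].
  rewrite inE; case JV : (J \subset V) => //=.
  rewrite -(inj_eq val_inj)/= inordK// ltnS -cV.
  exact: subset_leq_card.
rewrite -(inj_eq val_inj)/= inordK => [/eqP->//|].
by rewrite ltnS -cV subset_leq_card.
Qed.

(** * Risk bounds for an arbitrary class *)

Lemma measure_has d (T : measurableType d) (R : realType)
    (P : {measure set T -> \bar R}) (I : Type) (A : I -> T -> bool) (s : seq I) :
  (forall i, measurable [set x | A i x]) ->
  measurable [set x | has (A ^~ x) s] /\
  (P [set x | has (A ^~ x) s] <= \sum_(i <- s) P [set x | A i x])%E.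
Proof.
move=> mA; elim: s => [|i s [ms IH]] /=.
  by rewrite big_nil (_ : mkset _ = set0) ?measure0//; apply/seteqP; split.
have -> : [set x | A i x || has (A ^~ x) s] =
    [set x | A i x] `|` [set x | has (A ^~ x) s].
  by apply/seteqP; split => x /= => [/orP|H]; [|apply/orP].
split; first exact: measurableU.
rewrite big_cons; apply: (le_trans (measureU2 _ _ _)) => //.
by rewrite leeD2l.
Qed.

Section risk_bounds.
Context (R : realType) (n : nat) (C : {set {set 'I_n}}) (mu : R).
Hypothesis C0 : (0 < #|C|)%N.
Local Notation T := (n.-tuple (measurableTypeR R)).

(** Makes [law_chernoff] available under the null law, with mean 0 and any [S]. *)
Lemma law_0 S : law 0 S = law0 R n.
Proof. by rewrite /law /law0; congr prod_prob; apply/funext => i; case: ifP. Qed.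

Lemma min_risk_le f : min_risk C mu <= risk C mu f.
Proof. by have [g <-] := min_risk_attained mu C0; apply. Qed.

Lemma measurable_eqb (f : {mfun T >-> bool}) b : measurable [set x | f x = b].
Proof.
rewrite -[X in measurable X]setTI.
exact: (measurable_funPT f measurableT [set b]).
Qed.

(** The threshold [t] stays free. From [0 <= t] the false alarms are upper tails, joined by a union
    bound; from [t <= mu K] a missed [S] is a lower tail of its own [X_S]. *)
Lemma min_risk_scan (K : nat) (t delta : R) : (0 < K)%N ->
  (forall S, S \in C -> #|S| = K) -> 0 <= t -> t <= mu * K%:R ->
  #|C|%:R * expR (- (t ^+ 2 / (2 * K%:R))) <= delta / 2 ->
  expR (- ((t - mu * K%:R) ^+ 2 / (2 * K%:R))) <= delta / 2 ->
  min_risk C mu <= delta.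
Proof.
move=> K0 cK t0 tmu H0 HS.
pose A (S : {set 'I_n}) (x : T) := t <= \sum_(i in S) tnth x i.
have mA S : measurable [set x | A S x].
  rewrite (_ : mkset _ = (fun x : T => \sum_(i in S) tnth x i) @^-1` `[t, +oo[).
    rewrite -[_ @^-1` _]setTI; apply: measurable_sum_tnth => //.
  by apply/seteqP; split => x /=; rewrite in_itv/= andbT.
have mf : measurable_fun setT (fun x : T => has (A ^~ x) (enum C)).
  apply: (measurable_fun_bool true).
  by rewrite setTI; exact: (proj1 (measure_has (law0 R n) (enum C) mA)).
pose f : {mfun T >-> bool} :=
  HB.pack (fun x => has (A ^~ x) (enum C)) (isMeasurableFun.Build _ _ _ _ _ mf).
apply: (le_trans (min_risk_le f)); rewrite /risk [leRHS]splitr.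
apply: lerD.
  apply: le_trans H0; rewrite -lee_fin fineK ?fin_num_measure//; last first.
    exact: (measurable_eqb f true).
  apply: (le_trans (proj2 (measure_has (law0 R n) (enum C) mA))).
  rewrite mulr_natl -sumr_const -sumEFin -big_enum/=.
  rewrite !big_enum; apply: lee_sum => S SC; rewrite -(law_0 S).
  have := @law_chernoff R n 0 t S [set x | A S x].
  rewrite mul0r subr0 cK//; apply => //.
  by move=> x /= Ax; rewrite mulr_ge0// subr_ge0.
rewrite ler_pdivrMl ?ltr0n//.
rewrite mulr_natl -sumr_const; apply: ler_sum => S SC; apply: le_trans HS.
have mB := measurable_eqb f false.
rewrite -lee_fin fineK ?fin_num_measure// -(cK _ SC).
apply: law_chernoff => //; first by rewrite cK.
move=> x /= /negbT/hasPn/(_ S); rewrite mem_enum => /(_ SC).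
rewrite /A -ltNge => Ax.
by rewrite mulr_le0 ?subr_le0 ?cK// ltW.
Qed.

(** The double sum is [N^2] times the second moment of the average likelihood ratio, so the
    hypothesis bounds that moment by 2. *)
Lemma min_risk_ge_half :
  \sum_(S in C) \sum_(S' in C) expR (mu ^+ 2) ^+ #|S :&: S'| <=
    2 * #|C|%:R ^+ 2 ->
  2^-1 <= min_risk C mu.
Proof.
move=> H; have [f <- _] := min_risk_attained mu C0.
have N0 : 0 < #|C|%:R :> R by rewrite ltr0n.
set N : R := #|C|%:R in H N0.
pose F := [set x | f x = true]; pose G := [set x | f x = false].
have mF : measurable F by exact: measurable_eqb.
have mG : measurable G by exact: measurable_eqb.
pose l (S : {set 'I_n}) (x : T) :=
  expR (mu * \sum_(i in S) tnth x i - #|S|%:R * mu ^+ 2 / 2).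
have ml S : measurable_fun setT (l S).
  apply: measurableT_comp => //; apply: measurable_funB => //.
  by apply: measurable_funM => //; exact: measurable_sum_tnth.
have l0 S x : 0 <= l S x by exact: expR_ge0.
have meas_sum (g : {set 'I_n} -> T -> R) :
    (forall S, measurable_fun setT (g S)) ->
    measurable_fun setT (fun x => \sum_(S in C) g S x).
  move=> mg; rewrite (_ : (fun x => _) = fun x => \sum_(S <- enum C) g S x).
    exact: measurable_sum.
  by apply/funext => x; rewrite big_enum.
have iE (g : {set 'I_n} -> T -> R) :
    (forall S, measurable_fun setT (g S)) -> (forall S x, 0 <= g S x) ->
    (\int[law0 R n]_x (\sum_(S in C) g S x)%:E =
     \sum_(S in C) \int[law0 R n]_x (g S x)%:E)%E.
  move=> mg g0; rewrite -[RHS]big_enum/= -ge0_integral_sum//.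
  - by apply: eq_integral => x _; rewrite sumEFin big_enum.
  - by move=> S; exact/measurable_EFinP.
  - by move=> S x _; rewrite lee_fin.
have iS S (A : set T) : measurable A ->
    (\int[law0 R n]_x (l S x * \1_A x)%:E = law mu S A)%E.
  move=> mA; rewrite law_density// [RHS]integral_mkcond.
  by apply: eq_integral => x _; rewrite epatch_indic.
have iL : (\int[law0 R n]_x (\sum_(S in C) l S x)%:E = N%:E)%E.
  rewrite iE// /N -sumr_const -sumEFin; apply: eq_bigr => S _.
  transitivity (law mu S setT); last by rewrite probability_setT.
  rewrite -iS//.
  by apply: eq_integral => x _; rewrite indicT mulr1.
have mLL S S' : measurable_fun setT (fun x => l S x * l S' x).
  exact: measurable_funM.
have iSS S S' : (\int[law0 R n]_x (l S x * l S' x)%:E =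
    (expR (mu ^+ 2) ^+ #|S :&: S'|)%:E)%E.
  (* [c] collects the deterministic parts of the two log-ratios; it cancels the square terms of the
     exponential moment and leaves [mu^2 #|S :&: S'|]. *)
  pose c := (#|S|%:R * mu ^+ 2 + #|S'|%:R * mu ^+ 2) / 2.
  under eq_integral => x _.
    rewrite -expRD (_ : _ + _ = - c + (mu * \sum_(i in S) tnth x i +
      mu * \sum_(i in S') tnth x i)); last by rewrite /c; lra.
    rewrite expRD EFinM; over.
  rewrite ge0_integralZl ?lee_fin ?expR_ge0//; last first.
    apply/measurable_EFinP/measurableT_comp => //; apply: measurable_funD;
      by apply: measurable_funM => //; exact: measurable_sum_tnth.
  rewrite law0_mgf_sum2 -EFinM -expRD -expRM_natl; congr (expR _)%:E.
  by rewrite /c expr2; ring.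
pose q (x : T) := \sum_(S in C) \sum_(S' in C) l S x * l S' x.
have qE x : q x = (\sum_(S in C) l S x) ^+ 2.
  by rewrite expr2 mulr_suml; apply: eq_bigr => S _; rewrite mulr_sumr.
have mq : measurable_fun setT q.
  by apply: (meas_sum _ _) => S; exact: meas_sum (mLL S).
have iq : (\int[law0 R n]_x (q x)%:E <= (2 * N ^+ 2)%:E)%E.
  rewrite iE => [|S|S x]; last 2 first.
  - exact: meas_sum (mLL S).
  - by apply: sumr_ge0 => S' _; rewrite mulr_ge0.
  apply: (@le_trans _ _ (\sum_(S in C) \sum_(S' in C)
      expR (mu ^+ 2) ^+ #|S :&: S'|)%:E); last by rewrite lee_fin.
  rewrite -sumEFin; apply: lee_sum => S _.
  rewrite iE => [|S'|S' x]; [|exact: mLL|by rewrite mulr_ge0].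
  by rewrite -sumEFin; apply: lee_sum => S' _; rewrite iSS.
(* Here [L] is the unnormalized sum, hence the constant [(4 * N)^-1]. Where [f x] is true the claim
   is [(L - 2 N)^2 >= 0]; elsewhere the middle term already equals [L]. *)
have key x : \sum_(S in C) l S x <=
    N * \1_F x + \sum_(S in C) l S x * \1_G x + (4 * N)^-1 * q x.
  rewrite -mulr_suml qE; set L := \sum_(S in C) l S x.
  have L0 : 0 <= L by apply: sumr_ge0.
  have D0 : 0 <= (4 * N)^-1 * L ^+ 2 by rewrite mulr_ge0 ?sqr_ge0// invr_ge0; lra.
  rewrite !indicE; case fx : (f x).
    rewrite mem_set// memNset /G/= ?fx// mulr0 mulr1 addr0.
    rewrite -(ler_pM2l (_ : 0 < 4 * N)); last lra.
    rewrite mulrDr mulrA mulfV ?mul1r; last by rewrite gt_eqF//; lra.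
    by have := sqr_ge0 (L - 2 * N); nra.
  by rewrite memNset /F/= ?fx// mem_set// mulr0 mulr1 add0r lerDl.
have main : (N%:E <= N%:E * law0 R n F + \sum_(S in C) law mu S G +
    ((4 * N)^-1 * (2 * N ^+ 2))%:E)%E.
  have cF : (\int[law0 R n]_x (N * \1_F x)%:E = N%:E * law0 R n F)%E.
    under eq_integral => x _ do rewrite EFinM.
    rewrite ge0_integralZl ?lee_fin ?ltW//; last first.
      exact/measurable_EFinP.
    by rewrite integral_indic// setIT.
  have mlG S : measurable_fun setT (fun x => l S x * \1_G x).
    by apply: measurable_funM.
  have lG0 S x : 0 <= l S x * \1_G x by rewrite mulr_ge0.
  have mlGs : measurable_fun setT (fun x => \sum_(S in C) l S x * \1_G x).
    exact: meas_sum.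
  have q0 x : 0 <= q x by rewrite qE sqr_ge0.
  have cG : (\int[law0 R n]_x (\sum_(S in C) l S x * \1_G x)%:E =
      \sum_(S in C) law mu S G)%E.
    by rewrite iE//; apply: eq_bigr => S _; rewrite iS.
  have c0 : 0 <= (4 * N)^-1 by rewrite invr_ge0; lra.
  have cq : (\int[law0 R n]_x ((4 * N)^-1 * q x)%:E <=
      ((4 * N)^-1 * (2 * N ^+ 2))%:E)%E.
    under eq_integral => x _ do rewrite EFinM.
    rewrite ge0_integralZl ?lee_fin//; last 2 first.
    - exact/measurable_EFinP.
    - by move=> x _; rewrite lee_fin.
    by rewrite EFinM lee_wpmul2l// lee_fin.
  have mN : measurable_fun setT (fun x : T => N * \1_F x).
    by apply: measurable_funM.
  apply: (le_trans _ (leeD2l _ cq)); rewrite -cF -cG -iL.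
  have N1 x : 0 <= N * \1_F x by rewrite mulr_ge0// ltW.
  have s0 x : 0 <= \sum_(S in C) l S x * \1_G x by exact: sumr_ge0.
  pose h x := N * \1_F x + \sum_(S in C) l S x * \1_G x.
  have h0 x : 0 <= h x by rewrite addr_ge0.
  have mh : measurable_fun setT h by exact: measurable_funD.
  have -> : (\int[law0 R n]_x (N * \1_F x)%:E +
      \int[law0 R n]_x (\sum_(S in C) l S x * \1_G x)%:E =
      \int[law0 R n]_x (h x)%:E)%E.
    by rewrite -ge0_integralD//; first [move=> x _; rewrite lee_fin
      | exact/measurable_EFinP].
  have mcq : measurable_fun setT (fun x => (4 * N)^-1 * q x).
    exact: measurable_funM.
  have cq0 x : 0 <= (4 * N)^-1 * q x by rewrite mulr_ge0.
  rewrite -ge0_integralD//; try by [move=> x _; rewrite lee_fin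
      | exact/measurable_EFinP].
  apply: ge0_le_integral => //.
  - by move=> x _; rewrite lee_fin sumr_ge0.
  - by apply/measurable_EFinP; exact: meas_sum.
  - by apply/measurable_EFinP; exact: measurable_funD.
  - by move=> x _; rewrite -EFinD lee_fin.
have finE (P : probability T R) A : measurable A -> P A = (fine (P A))%:E.
  by move=> mA; rewrite fineK ?fin_num_measure.
move: main; rewrite finE// (eq_bigr _ (fun S _ => finE (law mu S) G mG)).
rewrite sumEFin -EFinM -!EFinD lee_fin => main.
rewrite /risk -/F -/G -/N.
rewrite -(ler_pM2l N0) mulrDr mulrA mulfV ?gt_eqF// mul1r.
(* The quadratic term costs [N / 2], so dividing the integrated inequality by [N] leaves risk at
   least [1 - 1/2]. *)
have : (4 * N)^-1 * (2 * N ^+ 2) = N / 2 by field; rewrite gt_eqF.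
move: main; set u := \sum_(S in C) _; set v := fine _ => main E.
rewrite E in main; lra.
Qed.

End risk_bounds.

(** * Cliques: size of the class and second moment *)

(** With [x = k / m], the number ['C(m, k) x^k] is one term of [(1 + x)^m <= exp(m x) = exp(k)]. *)
Lemma bin_le_expR (R : realType) m k : (0 < k)%N -> (k <= m)%N ->
  'C(m, k)%:R <= expR (k%:R * ln (m%:R * expR 1 / k%:R)) :> R.
Proof.
move=> k0 km; have m0 : (0 < m)%N by exact: leq_trans km.
have kR : 0 < k%:R :> R by rewrite ltr0n.
have mR : 0 < m%:R :> R by rewrite ltr0n.
rewrite expRM_natl lnK ?posrE ?divr_gt0 ?mulr_gt0 ?expR_gt0//.
pose x : R := k%:R / m%:R.
have x0 : 0 < x by exact: divr_gt0.
have H : 'C(m, k)%:R * x ^+ k <= expR 1 ^+ k.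
  apply: (@le_trans _ _ ((1 + x) ^+ m)).
    rewrite exprDn (bigD1 (Ordinal (km : (k < m.+1)%N)))//=.
    rewrite expr1n mul1r mulr_natl lerDl sumr_ge0// => i _.
    by rewrite mulrn_wge0// expr1n mul1r exprn_ge0// ltW.
  rewrite -expRM_natl mulr1.
  rewrite (_ : k%:R = m%:R * x); last by rewrite mulrC divfK// gt_eqF.
  rewrite expRM_natl lerXn2r ?nnegrE ?expR_ge0 ?expR_ge1Dx//.
  by rewrite addr_ge0// ltW.
rewrite (_ : m%:R * expR 1 / k%:R = expR 1 / x); last first.
  by rewrite /x invf_div mulrA [expR 1 * _]mulrC.
by rewrite expr_div_n ler_pdivlMr ?exprn_gt0.
Qed.

Section clique_moment.
Context (m n k : nat) (e : 'I_n -> {set 'I_m}).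
Hypothesis k_ge2 : (2 <= k)%N.
Hypothesis e_inj : injective e.
Hypothesis e_edges : forall A : {set 'I_m}, #|A| = 2%N <-> exists i, e i = A.

Let edges (V : {set 'I_m}) := [set i | e i \subset V]%SET.

Lemma card_edges (V : {set 'I_m}) : #|edges V| = 'C(#|V|, 2).
Proof.
apply: (card_clique e_inj e_edges); apply/imsetP; exists V => //.
by rewrite inE.
Qed.

Lemma edgesI V W : (edges V :&: edges W)%SET = edges (V :&: W)%SET.
Proof. by apply/setP => i; rewrite !inE finset.subsetI. Qed.

Lemma big_clique_class (R : realType) (F : {set 'I_n} -> R) :
  \sum_(S in clique_class k e) F S =
  \sum_(V : {set 'I_m} | #|V| == k) F (edges V).
Proof.
rewrite /clique_class big_imset/=; last first.
  (* Injectivity on [k]-sets is read off from cardinalities: the image has as many elements as there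
     are [k]-sets. *)
  apply/imset_injP; rewrite (card_clique_class k_ge2 e_edges).
  rewrite -[in X in 'C(X, _)](card_ord m) -card_draws.
  by apply/eqP/eq_card => V; rewrite !inE.
by apply: eq_bigl => V; rewrite !inE.
Qed.

(** Two cliques share exactly the edges inside their common vertices. With [x = k / m] the two
    numerical hypotheses are the conditions [2 k x <= 1] and [2 x q^k <= 1] of the series bound. *)
Lemma clique_second_moment (R : realType) (q : R) : (0 < m)%N -> 0 <= q ->
  (2 * k ^ 2 <= m)%N -> 2 * k%:R * q ^+ k <= m%:R ->
  \sum_(S in clique_class k e) \sum_(S' in clique_class k e) q ^+ #|S :&: S'|
    <= 2 * #|clique_class k e|%:R ^+ 2.
Proof.
move=> m0 q0 km qm.
have mR : 0 < m%:R :> R by rewrite ltr0n.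
have s2 : \sum_(j < k.+1)
    'C(k, j)%:R * (k%:R / m%:R) ^+ j * q ^+ 'C(j, 2) <= 2.
  apply: clique_series_le => //.
  - rewrite !mulrA ler_pdivrMr// mul1r -mulrA -expr2 -natrX -natrM ler_nat.
    by [].
  - by rewrite mulrA mulrAC ler_pdivrMr// mul1r.
rewrite (card_clique_class k_ge2 e_edges) big_clique_class.
apply: (@le_trans _ _ (\sum_(V : {set 'I_m} | #|V| == k) 'C(m, k)%:R * 2)).
  apply: ler_sum => V /eqP cV; rewrite big_clique_class.
  under eq_bigr => W _ do rewrite edgesI card_edges.
  by apply: (le_trans (sum_bin_expr_le m0 q0 cV)); rewrite ler_wpM2l.
rewrite sumr_const -[leLHS]mulr_natl.
rewrite (_ : #|_| = 'C(m, k)); last first.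
  rewrite -[in RHS](card_ord m) -card_draws.
  by apply: eq_card => V; rewrite !inE.
by rewrite expr2; nra.
Qed.

End clique_moment.

(** * Choice of the constants in the two regimes of [mu] *)

Theorem proposition4p1 (R : realType) (m k : nat)
    (hk : (2 <= k)%N)
    (hkm : k%:R <= Num.sqrt (m%:R * ln 2 / expR 1) :> R)
    (e : 'I_('C(m, 2)) -> {set 'I_m})
    (e_inj : injective e)
    (e_edges : forall A : {set 'I_m}, #|A| = 2%N <-> exists i, e i = A) :
  (forall delta : R, 0 < delta < 1 ->
   forall mu : R,
     2 * Num.sqrt ((k%:R - 1)^-1 * ln (m%:R * expR 1 / k%:R))
       + 4 * Num.sqrt (ln (2 / delta) / (k%:R * (k%:R - 1))) <= mu ->
     min_risk (clique_class k e) mu <= delta)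
  /\
  (forall mu : R, 0 < mu ->
     mu <= Num.sqrt (k%:R^-1 * ln (m%:R / (2 * k%:R))) ->
     2^-1 <= min_risk (clique_class k e) mu).
Proof.
have k_gt0 : (0 < k)%N by exact: ltnW.
have e2 : 2 <= expR 1 :> R by have := @expR_ge1Dx R 1; lra.
have ln2_ge0 : 0 <= ln 2 :> R by apply: ln_ge0; lra.
have ln2_le1 : ln 2 <= 1 :> R by rewrite -ler_expR lnK// posrE.
(* The square-root hypothesis enters through this consequence, by [e >= 2] and [log 2 <= 1]. *)
have k2m : (2 * k ^ 2 <= m)%N.
  have y0 : 0 <= m%:R * ln 2 / expR 1 :> R by rewrite divr_ge0 ?expR_ge0 ?mulr_ge0.
  have : k%:R ^+ 2 <= m%:R * ln 2 / expR 1 :> R.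
    by rewrite -[leRHS]sqr_sqrtr// lerXn2r ?nnegrE ?sqrtr_ge0.
  rewrite ler_pdivlMr ?expR_gt0// -(ler_nat R) natrM natrX => H.
  have k2 : 0 <= k%:R ^+ 2 :> R by exact: sqr_ge0.
  have H1 : k%:R ^+ 2 * 2 <= k%:R ^+ 2 * expR 1 :> R by rewrite ler_wpM2l.
  have H2 : m%:R * ln 2 <= m%:R * 1 :> R by rewrite ler_wpM2l.
  by rewrite mulrC -[leRHS]mulr1 (le_trans H1)// (le_trans H).
have km2 : (2 * k <= m)%N.
  by apply: leq_trans k2m; rewrite leq_mul2l/= -[leqLHS]expn1 leq_pexp2l.
have km : (k <= m)%N by apply: leq_trans km2; rewrite leq_pmull.
have m0 : (0 < m)%N by exact: leq_trans km.
have k1 : 0 < k%:R - 1 :> R by rewrite subr_gt0 ltr1n.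
have kR : 0 < k%:R :> R by rewrite ltr0n.
have mR : 0 < m%:R :> R by rewrite ltr0n.
have C0 : (0 < #|clique_class k e|)%N.
  by rewrite (card_clique_class hk e_edges) bin_gt0.
split => [delta /andP[d0 d1] mu|mu mu0] hmu.
  set D : R := k%:R * (k%:R - 1).
  have DE : D = 2 * 'C(k, 2)%:R.
    by rewrite -natrM -mul_bin_diag bin1 natrM /D -subn1 natrB.
  have D0 : 0 < D by exact: mulr_gt0.
  have K0 : 0 < 'C(k, 2)%:R :> R by rewrite ltr0n bin_gt0.
  set l := ln (m%:R * expR 1 / k%:R) in hmu.
  have l0 : 0 <= l.
    apply: ln_ge0; rewrite ler_pdivlMr// mul1r.
    apply: (@le_trans _ _ (m%:R * 1)); first by rewrite mulr1 ler_nat.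
    by rewrite ler_wpM2l// (le_trans _ e2)// ler1n.
  set B := ln (2 / delta) in hmu.
  have d2 : 1 <= 2 / delta by rewrite ler_pdivlMr//; lra.
  have B0 : 0 <= B by exact: ln_ge0.
  set a := Num.sqrt (_ * l) in hmu; set b := Num.sqrt (B / _) in hmu.
  have a2 : a ^+ 2 = l / (k%:R - 1).
    by rewrite sqr_sqrtr 1?mulrC// divr_ge0// ltW.
  have b2 : b ^+ 2 = B / D.
    by rewrite sqr_sqrtr// divr_ge0// ltW.
  have a0 : 0 <= a by exact: sqrtr_ge0.
  have b0 : 0 <= b by exact: sqrtr_ge0.
  have Da2 : D * a ^+ 2 = k%:R * l.
    by rewrite a2 /D; field; rewrite gt_eqF.
  have Db2 : D * b ^+ 2 = B by rewrite b2; field; rewrite gt_eqF.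
  have eB : expR (- B) = delta / 2.
    by rewrite expRN lnK ?posrE ?divr_gt0// invf_div.
  have Db0 : 0 <= D * b by rewrite mulr_ge0// ltW.
  (* The lower bound on [mu] is [2 a + 4 b] and [D = 2 K], so [mu K >= D (a + 2 b)]. The threshold
     [t = D (a + b)] leaves a margin [D b] on the missed-detection side. *)
  have gap : D * b <= mu * 'C(k, 2)%:R - D * (a + b).
    have : 0 <= 'C(k, 2)%:R * (mu - (2 * a + 4 * b)).
      by rewrite mulr_ge0 ?subr_ge0// ltW.
    by rewrite DE; lra.
  apply: (@min_risk_scan _ _ _ _ C0 'C(k, 2) (D * (a + b))).
  - by rewrite bin_gt0.
  - exact: card_clique.
  - by rewrite mulr_ge0 ?addr_ge0// ltW.
  - by lra.
  (* Here [t^2 / 2K = D (a + b)^2 >= D a^2 + D b^2 = k l + B]: the first part pays for the size of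
     the class, the second gives [delta / 2]. *)
  - rewrite (card_clique_class hk e_edges) -eB -DE.
    apply: (@le_trans _ _ (expR (k%:R * l) * expR (- (D * (a + b) ^+ 2)))).
      rewrite ler_pM ?expR_ge0//; first exact: bin_le_expR.
      rewrite ler_expR lerN2.
      rewrite le_eqVlt; apply/orP; left; apply/eqP; field.
      by rewrite gt_eqF.
    rewrite -expRD ler_expR -Da2 -[in leRHS]Db2.
    have : 0 <= D * (a * b) by rewrite mulr_ge0 ?mulr_ge0// ltW.
    by rewrite sqrrD !mulrDr; lra.
  - rewrite -eB ler_expR lerN2 -DE -Db2.
    rewrite ler_pdivlMr// mulrAC -expr2 -exprMn -[leRHS]sqrrN opprB.
    by rewrite lerXn2r ?nnegrE// (le_trans Db0).
apply: min_risk_ge_half => //.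
set x := m%:R / (2 * k%:R) in hmu.
have x1 : 1 <= x.
  by rewrite ler_pdivlMr ?mulr_gt0// mul1r -natrM ler_nat.
have x0 : 0 < x by lra.
apply: clique_second_moment => //.
(* Since [x >= 1] the radicand is nonnegative, so the square root is not the default value 0 and
   squaring is exact. *)
have mu2 : mu ^+ 2 <= k%:R^-1 * ln x.
  have -> : k%:R^-1 * ln x = Num.sqrt (k%:R^-1 * ln x) ^+ 2.
    by rewrite sqr_sqrtr// mulr_ge0 ?invr_ge0 ?ln_ge0// ltW.
  by rewrite lerXn2r ?nnegrE ?sqrtr_ge0// ltW.
have : expR (mu ^+ 2) ^+ k <= x.
  rewrite -expRM_natl -[leRHS]lnK ?posrE// ler_expR.
  by move: mu2; rewrite mulrC ler_pdivlMr// mulrC.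
by rewrite /x ler_pdivlMr ?mulr_gt0// mulrC.
Qed.
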